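(* Let $(X,\operatorname{dist})$ be a compact metric space and $f\colon X\to X$ a homeomorphism. The following statements are equivalent: (1) $f$ is dw-expansive with central dimension $D=0$; (2) $f$ is partially expansive with central dimension $D=0$; (3) $f$ is cw-expansive.
   Context: Let $\tau$ be the topology of $X$. For $\mathcal{U}\subset\tau$, write $\operatorname{ord}\mathcal{U}\leq n$ if for all $\mathcal{V}\subset\mathcal{U}$ with $|\mathcal{V}|>n+1$ one has $\bigcap\mathcal{V}=\emptyset$; $\operatorname{ord}\mathcal{U}=n$ if $\operatorname{ord}\mathcal{U}\leq n$ but not $\operatorname{ord}\mathcal{U}\leq n-1$. Let $\operatorname{mesh}(\mathcal{U})=\sup_{U\in\mathcal{U}}\operatorname{diam}(U)$. For $\epsilon>0$ and $Y\subset X$ compact define $$\dim_\epsilon Y=\inf\{\operatorname{ord}\mathcal{U}:\mathcal{U}\subset\tau,\ Y\subset\bigcup\mathcal{U},\ \operatorname{mesh}(\mathcal{U})<\epsilon\},$$ and $\dim Y=\lim_{\epsilon\to0}\dim_\epsilon Y$ (this is the usual topological dimension). $f$ is dw-expansive with central dimension $D\ge 0$ if there is $\sigma>0$ such that if $C\subset X$ is compact with $\dim(C)>D$ then there is $n\in\mathbb{Z}$ such that $\dim_\sigma(f^n(C))>D$. A set is non-trivial if it has more than one point. Given an integer $D\geq -1$, $f$ is partially expansive with central dimension $D$ if there is $\epsilon>0$ such that for every non-trivial compact set $C\subset X$ with $\dim(C)>D$ there is $k\in\mathbb{Z}$ with $\operatorname{diam}(f^k(C))\geq\epsilon$. $f$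 is cw-expansive if there is $\delta>0$ such that if $C\subset X$ is a continuum (non-empty compact connected set) and $\operatorname{diam}(f^j(C))<\delta$ for all $j\in\mathbb{Z}$, then $C$ is a singleton. *)

(* Defs.v *)
From HB Require Import structures.
From mathcomp Require Import all_boot all_order all_algebra.
From mathcomp Require Import all_classical all_reals all_analysis.

Set Implicit Arguments.
Unset Strict Implicit.
Unset Printing Implicit Defensive.

Import Order.TTheory GRing.Theory Num.Theory.
Import numFieldNormedType.Exports.

Local Open Scope classical_set_scope.
Local Open Scope card_scope.
Local Open Scope ring_scope.

(* [g] is meant to be the inverse of [f]; [Negz k] is [- (k + 1)]. *)
Definition iterz (T : Type) (f g : T -> T) (n : int) : T -> T :=
  match n with
  | Posz k => iter k f
  | Negz k => iter k.+1 g
  end.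

(* The families are sets of subsets, possibly infinite: [|V| > n + 1] means
   that [V] has at least [m] members for some natural number [m > n + 1]. *)
Definition cover_ord_le (T : Type) (U : set (set T)) (n : int) : Prop :=
  forall V : set (set T), V `<=` U ->
    (exists2 m : nat, n + 1 < m%:Z & `I_m #<= V) ->
    \bigcap_(A in V) A = set0.

Section metric_dimension.
Context {R : realType} {X : metricType R}.
Implicit Types (A C Y : set X) (U : set (set X)) (D : int).

(* The least [n >= -1] such that [cover_ord_le U n], and [+oo] if there is none. *)
Definition cover_ord U : \bar R :=
  ereal_inf [set (n%:~R)%:E | n in [set n : int | -1 <= n /\ cover_ord_le U n]].

(* The extra element 0 only matters for the empty set and the empty family,
   whose diameter and mesh are 0 by convention (and not -oo). *)
Definition diam A : \bar R :=
  ereal_sup (0%E |` [set (mdist x y)%:E | x in A & y in A]).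

Definition mesh U : \bar R := ereal_sup (0%E |` [set diam A | A in U]).

Definition dim_eps (e : R) Y : \bar R :=
  ereal_inf [set cover_ord U | U in [set U : set (set X) |
    [/\ U `<=` open, Y `<=` \bigcup_(A in U) A & (mesh U < e%:E)%E]]].

Definition top_dim Y : \bar R := lim (dim_eps e Y @[e --> 0^'+]).

Definition nontrivial_set A : Prop := exists x y, [/\ A x, A y & x <> y].

Definition continuum C : Prop := [/\ C !=set0, compact C & connected C].

Definition dw_expansive (f g : X -> X) D : Prop :=
  exists2 s : R, 0 < s &
    forall C, compact C -> ((D%:~R)%:E < top_dim C)%E ->
      exists n : int, ((D%:~R)%:E < dim_eps s (iterz f g n @` C))%E.

Definition partially_expansive (f g : X -> X) D : Prop :=
  exists2 e : R, 0 < e &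
    forall C, nontrivial_set C -> compact C -> ((D%:~R)%:E < top_dim C)%E ->
      exists k : int, (e%:E <= diam (iterz f g k @` C))%E.

Definition cw_expansive (f g : X -> X) : Prop :=
  exists2 d : R, 0 < d &
    forall C, continuum C ->
      (forall j : int, (diam (iterz f g j @` C) < d%:E)%E) ->
      exists x, C = [set x].

End metric_dimension.

(* Main.v *)
Require Import Defs.
From HB Require Import structures.
From mathcomp Require Import all_boot all_order all_algebra.
From mathcomp Require Import all_classical all_reals all_analysis.
From mathcomp Require Import lra.

Import Order.TTheory GRing.Theory Num.Theory.
Import numFieldNormedType.Exports.

Set Implicit Arguments.
Unset Strict Implicit.
Unset Printing Implicit Defensive.

Local Open Scope classical_set_scope.
Local Open Scope ring_scope.

(** Central dimension 0 sees a compact set only through the continua that it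
    contains. A cover has order at most 0 exactly when its members are
    pairwise disjoint, so [dim_eps e C] is positive exactly when no disjoint
    family of open sets of mesh less than [e] covers [C]
    ([dim_eps_gt0P]). Two facts follow.

    - A connected set lies in a single member of any disjoint open cover; hence
      a connected set of diameter at least [e] has positive [e]-dimension
      ([connected_dim_eps_gt0]), and every non-trivial connected set has
      positive dimension.
    - A compact set of positive dimension contains a non-trivial continuum
      ([continuum_in_positive_dim]). This is proved with [d]-chains, that is,
      walks in [C] with jumps shorter than [d]. If all the classes of the
      relation being joined by a [d]-chain were small for some [d], then their
      [d / 2]-neighbourhoods would form a disjoint open cover of small mesh.
      Otherwise, for every [d] there are two points far apart that are joined
      by a [d]-chain; by compactness these pairs accumulate at two distinct
      points [x] and [y] joined by [d]-chains for all [d]. The set of all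
      points joined to [x] in this way is compact, and it is connected, since
      chains that cross a gap between two pieces of it would accumulate at a
      point inside the gap that is again joined to [x] by [d]-chains for all
      [d].

    The three properties are then proved cyclically. If [f] is dw-expansive,
    a non-trivial continuum has an iterate of positive [s]-dimension, which
    cannot be covered by a single small ball, so [f] is cw-expansive. If [f] is
    cw-expansive, the continuum inside a compact set of positive dimension has
    a large iterate, and so does the set. If [f] is partially expansive, the
    same continuum has an iterate of diameter at least [e], which is connected
    and hence of positive [e]-dimension. *)

(** * Diameter, mesh and balls *)

Section diameter_and_mesh.
Context {R : realType} {X : metricType R}.
Implicit Types (A B : set X) (U : set (set X)) (c : R).

Lemma mdist_le_diam A x y : A x -> A y -> ((mdist x y)%:E <= diam A)%E.
Proof.
by move=> Ax Ay; apply: ereal_sup_ubound; right; exists x => //; exists y.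
Qed.

Lemma diam_le A c : 0 <= c ->
  (forall x y, A x -> A y -> mdist x y <= c) -> (diam A <= c%:E)%E.
Proof.
move=> c0 Ac; apply: ge_ereal_sup => _ [->|[x Ax [y Ay <-]]].
  by rewrite lee_fin.
by rewrite lee_fin Ac.
Qed.

Lemma diamS A B : A `<=` B -> (diam A <= diam B)%E.
Proof.
move=> AB; apply: ereal_sup_le => _ [->|[x Ax [y Ay <-]]]; first by left.
by right; exists x; [exact: AB|exists y => //; exact: AB].
Qed.

Lemma diam_le_mesh U A : U A -> (diam A <= mesh U)%E.
Proof. by move=> UA; apply: ereal_sup_ubound; right; exists A. Qed.

Lemma mesh_le U c : 0 <= c ->
  (forall A, U A -> (diam A <= c%:E)%E) -> (mesh U <= c%:E)%E.
Proof.
by move=> c0 Uc; apply: ge_ereal_sup => _ [->|[A UA <-]];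
  [rewrite lee_fin|exact: Uc].
Qed.

Lemma open_metric_ball (x : X) c : open (ball x c).
Proof.
rewrite openE => z; rewrite ballEmdist /= => xz.
apply/nbhs_ballP; exists (c - mdist x z) => /=; first by rewrite subr_gt0.
by move=> t; rewrite !ballEmdist /= => zt; have := metric_triangle x z t; lra.
Qed.

End diameter_and_mesh.

(** * Sets of positive dimension *)

Section positive_dimension.
Context {R : realType} {X : metricType R}.
Implicit Types (C K : set X) (U : set (set X)) (e : R).

Lemma cover_ord_le0P U : cover_ord_le U 0 <-> trivIset U id.
Proof.
split=> [U0 A B UA UB [z [Az Bz]]|dU V VU [m m1 /pcard_leP[h]]].
  apply: contrapT => AB.
  suff VU0 : \bigcap_(D in [set A; B]) D = set0.
    by suff : set0 z by []; rewrite -VU0 => D [->|->].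
  apply: U0; first by move=> D [->|->].
  exists 2%N => //.
  pose h := fun n : nat => if n is 0%N then A else B.
  have hinj : {in `I_2 &, injective h}.
    by move=> [|[|i]] [|[|j]]; rewrite !inE //= => _ _ // /esym.
  have /card_eqPle[_ +] := inj_card_eq hinj => /card_le_trans; apply.
  by apply: subset_card_le => _ [[|i] _ <-]; [left|right].
have m2 : (1 < m)%N by move: m1; rewrite add0r ltz_nat.
have m0 : (0 < m)%N by apply: ltn_trans m2.
have /= Vh0 := @funS _ _ _ _ h 0%N m0.
have /= Vh1 := @funS _ _ _ _ h 1%N m2.
apply/seteqP; split=> // z Vz.
have h01 : h 0%N = h 1%N.
  apply: dU; [exact: VU|exact: VU|].
  by exists z; split; apply: Vz.
have : 0%N = 1%N by apply: (@inj _ _ _ h) => //; rewrite inE.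
by [].
Qed.

Definition small_disjoint_cover e C U : Prop :=
  [/\ U `<=` open, C `<=` \bigcup_(A in U) A, (mesh U < e%:E)%E & trivIset U id].

(** Orders are integers or infinite: if no cover has order at most 0, then all
    orders are at least 1, and so is their infimum. *)
Lemma dim_eps_gt0P e C :
  (0 < dim_eps e C)%E <-> ~ exists U, small_disjoint_cover e C U.
Proof.
split=> [d0 [U [oU CU Ue dU]]|noU].
  move: d0; apply/negP; rewrite -leNgt.
  apply: ge_ereal_inf; exists (cover_ord U); first by exists U.
  apply: ge_ereal_inf; exists 0%E => //.
  by exists 0 => //; split => //; apply/cover_ord_le0P.
apply: (@lt_le_trans _ _ 1%E); first by rewrite lte_fin.
apply: le_ereal_inf_tmp => _ [U [oU CU Ue] <-].
apply: le_ereal_inf_tmp => _ [n [n1 Un] <-].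
rewrite lee_fin (ler_int _ 1) leNgt; apply/negP => n_lt1.
apply: noU; exists U; split => //; apply/cover_ord_le0P => V VU [m m1 mV].
apply: Un VU _; exists m => //; apply: le_lt_trans m1.
by rewrite lerD2r -ltzD1 add0r.
Qed.

Lemma dim_eps_anti C :
  {homo (fun e : R => dim_eps e C) : a b / a <= b >-> (b <= a)%E}.
Proof.
move=> a b ab; apply: ereal_inf_le_tmp => _ [U [oU CU Ua] <-].
by exists U => //; split => //; apply: lt_le_trans Ua _; rewrite lee_fin.
Qed.

Lemma dim_epsS e C K : K `<=` C -> (dim_eps e K <= dim_eps e C)%E.
Proof.
move=> KC; apply: ereal_inf_le_tmp => _ [U [oU CU Ue] <-].
by exists U => //; split => // x /KC /CU.
Qed.

(** [dim_eps e C] grows as [e] decreases to 0, so its limit is its supremum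
    over [e > 0]. *)
Lemma top_dim_gt0P C :
  (0 < top_dim C)%E <-> exists2 e : R, 0 < e & (0 < dim_eps e C)%E.
Proof.
have -> : top_dim C = ereal_sup ((fun e : R => dim_eps e C) @` [set` `]0, +oo[ ]).
  apply: cvg_lim => //; apply: nonincreasing_at_right_cvge => //.
  by move=> a b _ _; exact: dim_eps_anti.
split=> [/ereal_sup_gt[_ [e + <-]]|[e e0 de]].
  by rewrite /= in_itv/= andbT; exists e.
apply: (lt_le_trans de); apply: ereal_sup_ubound; exists e => //=.
by rewrite in_itv/= andbT.
Qed.

(** The other members of the family form an open set, so the trace of [A] on [K]
    is both open and closed in [K]. *)
Lemma connected_sub_disjoint_open K U A : connected K -> U `<=` open ->
  trivIset U id -> K `<=` \bigcup_(B in U) B -> U A -> K `&` A !=set0 -> K `<=` A.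
Proof.
move=> cK oU dU KU UA KA; apply/setIidPl.
apply: cK => //; first by exists A => //; exact: oU.
exists (~` \bigcup_(B in U `\ A) B).
  by apply: open_closedC; apply: bigcup_open => B [UB _]; exact: oU.
apply/seteqP; split=> z [Kz Az]; split => //.
  by move=> [B [UB BA] Bz]; apply: BA; apply: dU => //; exists z.
have [B UB Bz] := KU _ Kz.
have [<-//|BA] := pselect (B = A).
by exfalso; apply: Az; exists B.
Qed.

Lemma connected_dim_eps_gt0 e K : 0 < e -> connected K ->
  (e%:E <= diam K)%E -> (0 < dim_eps e K)%E.
Proof.
move=> e0 cK eK; apply/dim_eps_gt0P => -[U [oU KU Ue dU]].
suff : (diam K < e%:E)%E by rewrite ltNge eK.
have [->|/set0P[x Kx]] := eqVneq K set0.
  apply: (@le_lt_trans _ _ 0%E); last by rewrite lte_fin.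
  exact: diam_le.
have [A UA Ax] := KU _ Kx.
apply: le_lt_trans Ue; apply: (le_trans _ (diam_le_mesh UA)).
by apply: diamS; apply: (connected_sub_disjoint_open cK oU) => //; exists x.
Qed.

Lemma connected_top_dim_gt0 K : connected K -> nontrivial_set K ->
  (0 < top_dim K)%E.
Proof.
move=> cK [x [y [Kx Ky xy]]].
have d0 : 0 < mdist x y by rewrite mdist_gt0; apply/eqP.
apply/top_dim_gt0P; exists (mdist x y) => //.
by apply: connected_dim_eps_gt0 => //; exact: mdist_le_diam.
Qed.

End positive_dimension.

(** * Chains and continua *)

Section chains.
Context {R : realType} {X : metricType R}.
Implicit Types (C K : set X) (d e : R) (x y z : X).

(** If, at every scale [d], the compact set [K] contains a pair related by
    [P d], then such pairs at scales tending to 0 accumulate at a pair of points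
    of [K]: a cluster point in [K `*` K] of the filter generated by the sets
    [S d]. *)
Lemma compact_pair_limit (P : R -> X -> X -> Prop) K : compact K ->
  (forall d, 0 < d -> exists x y, [/\ K x, K y & P d x y]) ->
  exists x y, [/\ K x, K y & forall e, 0 < e ->
    exists d u v, [/\ 0 < d <= e, mdist x u < e, mdist y v < e & P d u v]].
Proof.
move=> cK KP.
pose S d := [set p : X * X | [/\ K p.1, K p.2 &
  exists2 d', 0 < d' <= d & P d' p.1 p.2]].
pose F := filter_from [set d : R | 0 < d] S.
have FF : ProperFilter F.
  apply: filter_from_proper => [|d /= d0]; last first.
    have [x [y [Kx Ky Pxy]]] := KP _ d0.
    by exists (x, y); split => //; exists d => //; rewrite d0 lexx.
  apply: filter_from_filter => [|a b /= a0 b0]; first by exists 1 => /=.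
  exists (Num.min a b) => /=; first by rewrite lt_min a0 b0.
  move=> p [K1 K2 [d' /andP[d0]]]; rewrite le_min => /andP[da db] Pd.
  by split; split => //; exists d' => //; apply/andP.
have FK : F (K `*` K) by exists 1 => //= p [].
have [[x y] [[/= Kx Ky] clxy]] := compact_setX cK cK FF FK.
exists x, y; split => // e e0.
have Be : nbhs (x, y) (ball x e `*` ball y e).
  by exists (ball x e, ball y e) => //; split; exact: nbhsx_ballx.
have Fe : F (S e) by exists e.
have [[u v] [[/= _ _ [d d0e Pd]] []]] := clxy _ _ Fe Be.
by rewrite !ballEmdist /= => xu yv; exists d, u, v.
Qed.

(** [y] is the end of a finite walk from [x] whose further points are in [C] and
    whose jumps are shorter than [d]. Defining the reachable points as the least
    set containing [x] and closed under such jumps replaces induction on the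
    length of walks by a choice of [S]. *)
Definition chained C d x y : Prop := forall S : set X, S x ->
  (forall a b, S a -> C b -> mdist a b < d -> S b) -> S y.

Lemma chained_refl C d x : chained C d x x.
Proof. by move=> S. Qed.

Lemma chained_step C d x y z :
  chained C d x y -> C z -> mdist y z < d -> chained C d x z.
Proof. by move=> xy Cz yz S Sx Sstep; apply: (Sstep y) => //; exact: xy. Qed.

Lemma chained_trans C d x y z :
  chained C d x y -> chained C d y z -> chained C d x z.
Proof. by move=> xy yz S Sx Sstep; apply: yz => //; exact: xy. Qed.

Lemma chained_sym C d x y : C x -> chained C d x y -> chained C d y x.
Proof.
move=> Cx /(_ [set z | C z /\ chained C d z x])[|a b|//].
  by split => //; exact: chained_refl.
move=> [Ca ax] Cb ab; split => //; apply: (chained_trans _ ax).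
by apply: (chained_step (@chained_refl _ _ _)) => //; rewrite metric_sym.
Qed.

Lemma chained_mono C d e x y : d <= e -> chained C d x y -> chained C e x y.
Proof.
move=> de xy S Sx Sstep; apply: (xy S) => // a b Sa Cb ab.
by apply: (Sstep a) => //; exact: lt_le_trans de.
Qed.

(** The [d / 2]-neighbourhoods of two chain classes are disjoint, because a common
    point would allow a jump from one class to the other. Thickening increases
    the diameter by at most [d], which keeps the mesh below [e]. *)
Lemma chain_classes_cover C d e : 0 < d -> d <= e / 4 ->
  (forall x y, C x -> C y -> chained C d x y -> mdist x y <= e / 4) ->
  exists U, small_disjoint_cover e C U.
Proof.
move=> d0 de Cd.
pose N x := \bigcup_(w in [set w | C w /\ chained C d x w]) ball w (d / 2).
exists (N @` C); split.
- by move=> _ [x Cx <-]; apply: bigcup_open => w _; exact: open_metric_ball.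
- move=> x Cx; exists (N x); first by exists x.
  by exists x; [split|rewrite ballEmdist /= mdistxx; lra].
- apply: (@le_lt_trans _ _ (e / 2)%:E); last by rewrite lte_fin; lra.
  apply: mesh_le => [|_ [x Cx <-]]; first lra.
  apply: diam_le => [|z z' [w [Cw xw] +] [w' [Cw' xw'] +]]; first lra.
  rewrite !ballEmdist /= => wz wz'.
  have ww' : chained C d w w' by apply: (chained_trans _ xw'); exact: chained_sym.
  have := Cd _ _ Cw Cw' ww'; rewrite metric_sym in wz.
  have := metric_triangle z w z'; have := metric_triangle w w' z'; lra.
- move=> _ _ [x Cx <-] [y Cy <-] [z [[w [Cw xw] +] [v [Cv yv] +]]].
  rewrite !ballEmdist /= => wz vz.
  have xy : chained C d x y.
    apply: (chained_trans _ (chained_sym Cy yv)); apply: chained_step xw Cv _.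
    by rewrite metric_sym in vz; have := metric_triangle w z v; lra.
  apply/seteqP; split=> t [s [Cs xs] st]; exists s => //; split => //.
    exact: chained_trans (chained_sym Cx xy) xs.
  exact: chained_trans xy xs.
Qed.

(** For compact [C] and [x] in [C], this is the connected component of [x] in
    [C]. *)
Definition chain_limit C x : set X :=
  [set z | C z /\ forall d, 0 < d -> chained C d x z].

(** A last jump of length less than [d] leads to [z], so it suffices to reach
    points near [z]; this makes chain limits closed under all limits. *)
Lemma chain_limit_approx C x z : C z ->
  (forall d, 0 < d -> exists w, chained C d x w /\ mdist w z < d) ->
  chain_limit C x z.
Proof.
by move=> Cz H; split => // d /H[w [xw wz]]; exact: (chained_step xw).
Qed.

Lemma closed_chain_limit C x : closed C -> closed (chain_limit C x).
Proof.
move=> cC z clz; have Cz : C z.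
  by apply: cC => B /clz[w [[Cw _] Bw]]; exists w.
apply: chain_limit_approx => // d d0.
have [w [[Cw xw]]] := clz _ (nbhsx_ballx z d d0).
by rewrite ballEmdist /= metric_sym => wz; exists w; split => //; exact: xw.
Qed.

Lemma compact_gap K A B : compact K -> A `<=` K -> B `<=` K ->
  closed A -> closed B -> A `&` B = set0 ->
  exists2 e, 0 < e & forall x y, A x -> B y -> e <= mdist x y.
Proof.
move=> cK AK BK cA cB AB0; apply: contrapT => nogap.
have [d d0|x [y [Kx Ky xy]]] := compact_pair_limit
    (P := fun d u v => [/\ A u, B v & mdist u v < d]) cK.
  apply: contrapT => far; apply: nogap; exists d => // x y Ax By.
  rewrite leNgt; apply/negP => xy; apply: far; exists x, y.
  by split; [exact: AK|exact: BK|].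
have Ax : A x.
  apply: cA => V /nbhs_ballP[e /= e0 xV].
  have [d [u [v [_ xu _ [Au _ _]]]]] := xy _ e0.
  by exists u; split => //; apply: xV; rewrite ballEmdist.
suff Bx : B x by have : set0 x by rewrite -AB0.
apply: cB => V /nbhs_ballP[e /= e0 xV].
have e20 : 0 < e / 2 by lra.
have [d [u [v [/andP[_ de] xu _ [_ Bv uv]]]]] := xy _ e20.
exists v; split => //; apply: xV; rewrite ballEmdist /=.
by have := metric_triangle x u v; lra.
Qed.

(** If the set [K] of chain limits of [x] splits into relatively clopen pieces [B]
    and [B'], a gap [r] separates them, and a fine chain from [B] to [B'] must
    visit a point of [C] at distance at least [r / 3] from [K]. Such points,
    taken for finer and finer chains, accumulate at a point that belongs to [K],
    which is absurd. *)
Lemma connected_chain_limit C x : compact C -> C x ->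
  connected (chain_limit C x).
Proof.
move=> cC Cx; set K := chain_limit C x.
have KC : K `<=` C by move=> z [].
have clC : closed C by apply: compact_closed => //; exact: metric_hausdorff.
have clK : closed K by exact: closed_chain_limit.
move=> B [q Bq] [V oV BV] [F cF BF]; apply: contrapT => BK.
have sBK : B `<=` K by rewrite BV => z [].
have [p Kp Bp] : exists2 p, K p & ~ B p.
  apply: contrapT => nop; apply: BK; apply/seteqP; split => // z Kz.
  by apply: contrapT => Bz; apply: nop; exists z.
pose B' := K `\` B.
have [r r0 gap] : exists2 e, 0 < e & forall u v, B u -> B' v -> e <= mdist u v.
  apply: (compact_gap cC).
  - exact: subset_trans KC.
  - by move=> z [/KC].
  - by rewrite BF; exact: closedI.
  - have -> : B' = K `&` ~` V.
      rewrite /B' BV; apply/seteqP; split=> z [Kz nz]; split=> //.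
        by move=> Vz; apply: nz.
      by case.
    by apply: closedI => //; exact: open_closedC.
  - by apply/seteqP; split => // z [Bz [_]].
pose far z := forall w, K w -> r / 3 <= mdist w z.
have leave d : 0 < d -> d <= r / 3 ->
    exists z, [/\ C z, chained C d x z & far z].
  move=> d0 dr; apply: contrapT => nofar.
  have close_to_K z : C z -> chained C d x z -> exists2 w, K w & mdist w z < r / 3.
    move=> Cz xz; apply: contrapT => nonear; apply: nofar.
    exists z; split => // w Kw; rewrite leNgt; apply/negP => wz.
    by apply: nonear; exists w.
  have qp : chained C d q p.
    apply: (chained_trans _ (Kp.2 _ d0)); apply: chained_sym => //.
    exact: (sBK _ Bq).2.
  (* the r / 3-neighbourhood of B within the points reachable from x: no jump
     leads out of it, since r / 3 + d + r / 3 <= r *)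
  pose S := [set z | [/\ C z, chained C d x z &
    exists2 w, B w & mdist w z < r / 3]].
  have [_ _ [w Bw wp]] : S p.
    apply: qp.
      split; [exact/KC/sBK|exact: (sBK _ Bq).2|].
      by exists q => //; rewrite mdistxx; lra.
    move=> a b [Ca xa [w Bw wa]] Cb ab.
    have xb := chained_step xa Cb ab.
    split => //; have [v Kv vb] := close_to_K _ Cb xb.
    exists v => //; apply: contrapT => Bv.
    have := gap _ _ Bw (conj Kv Bv).
    have := metric_triangle w a v; have := metric_triangle a b v.
    rewrite (metric_sym b v); lra.
  by have := gap _ _ Bw (conj Kp Bp); lra.
have [d d0|z [z' [Cz _ zfar]]] := compact_pair_limit
    (P := fun d u _ => chained C d x u /\ far u) cC.
  have m0 : 0 < Num.min d (r / 3) by rewrite lt_min d0; lra.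
  have mr : Num.min d (r / 3) <= r / 3 by rewrite ge_min lexx orbT.
  have [z [Cz xz fz]] := leave _ m0 mr.
  exists z, z; split => //; split => //.
  by apply: chained_mono xz; rewrite ge_min lexx.
have Kz : K z.
  apply: chain_limit_approx => // d d0.
  have [d' [u [v [/andP[_ dd'] zu _ [xu _]]]]] := zfar _ d0.
  by exists u; split; [exact: chained_mono xu|rewrite metric_sym].
have r30 : 0 < r / 3 by lra.
have [d' [u [v [_ zu _ [_ fu]]]]] := zfar _ r30.
by have := fu _ Kz; lra.
Qed.

(** Positive dimension forbids the cover by chain classes at every scale; the far
    apart chained pairs that remain have two distinct limits in one set of chain
    limits. *)
Lemma continuum_in_positive_dim C : compact C -> (0 < top_dim C)%E ->
  exists K, [/\ K `<=` C, continuum K & nontrivial_set K].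
Proof.
move=> cC /top_dim_gt0P[e e0 /dim_eps_gt0P noU].
have pairs d : 0 < d -> exists x y, [/\ C x, C y &
    [/\ C x, chained C d x y & e / 4 <= mdist x y]].
  move=> d0; apply: contrapT => close; apply: noU.
  have m0 : 0 < Num.min d (e / 4) by rewrite lt_min d0; lra.
  have me : Num.min d (e / 4) <= e / 4 by rewrite ge_min lexx orbT.
  apply: (chain_classes_cover m0 me) => x y Cx Cy xy.
  rewrite leNgt; apply/negP => exy; apply: close.
  exists x, y; split => //; split => //; last exact: ltW.
  by apply: chained_mono xy; rewrite ge_min lexx.
have [x [y [Cx Cy lim]]] := compact_pair_limit cC pairs.
have clC : closed C by apply: compact_closed => //; exact: metric_hausdorff.
have Kx : chain_limit C x x by split => // d _; exact: chained_refl.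
exists (chain_limit C x); split => [z []//||].
  split; [by exists x| |exact: connected_chain_limit].
  by apply: subclosed_compact cC _ => [|z []//]; exact: closed_chain_limit.
exists x, y; split => //.
  apply: chain_limit_approx => // d d0.
  have [d' [u [v [/andP[_ dd'] xu yv [Cu uv _]]]]] := lim _ d0.
  exists v; rewrite metric_sym; split => //.
  apply: (chained_trans _ (chained_mono dd' uv)).
  exact: (chained_step (@chained_refl _ _ _)).
move=> xy; rewrite -{}xy in lim.
have e80 : 0 < e / 8 by lra.
have [d' [u [v [_ xu xv [_ _ uv]]]]] := lim _ e80.
by have := metric_triangle u x v; rewrite (metric_sym u x); lra.
Qed.

End chains.

(** * The three notions of expansiveness *)

Section expansiveness.
Context {R : realType} {X : metricType R}.

Lemma continuous_iter (T : topologicalType) (h : T -> T) n :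
  continuous h -> continuous (iter n h).
Proof.
move=> ch; elim: n => [|n IHn] x; first exact: cvg_id.
by apply: (@continuous_comp _ _ _ (iter n h) h); [exact: IHn|exact: ch].
Qed.

Lemma continuous_iterz (f g : X -> X) n :
  continuous f -> continuous g -> continuous (iterz f g n).
Proof. by move=> cf cg; case: n => n; exact: continuous_iter. Qed.

(** A set whose points are within [s / 4] of one of them lies in a ball of
    diameter at most [s / 2], and this single ball is a cover of order 0. *)
Lemma dw_cw_expansive (f g : X -> X) : dw_expansive f g 0 -> cw_expansive f g.
Proof.
move=> [s s0 dw]; exists (s / 4); first by lra.
move=> C [[x Cx] cC kC] smallC; apply: contrapT => nC.
have tC : nontrivial_set C.
  apply: contrapT => tC; apply: nC; exists x; apply/seteqP; split => [y Cy|y ->//].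
  by apply: contrapT => yx; apply: tC; exists y, x.
have [n] := dw C cC (connected_top_dim_gt0 kC tC).
move=> /dim_eps_gt0P; apply.
exists [set ball (iterz f g n x) (s / 4)]; split.
- by move=> _ ->; exact: open_metric_ball.
- move=> _ [y Cy <-]; exists (ball (iterz f g n x) (s / 4)) => //.
  rewrite ballEmdist /= -lte_fin; apply: le_lt_trans (smallC n).
  by apply: mdist_le_diam; [exists x|exists y].
- apply: (@le_lt_trans _ _ (s / 2)%:E); last by rewrite lte_fin; lra.
  apply: mesh_le => [|_ ->]; first lra.
  apply: diam_le => [|y z]; first lra.
  set c := iterz f g n x.
  rewrite ballEmdist /= => cy cz; rewrite metric_sym in cy.
  by have := metric_triangle y c z; lra.
- by move=> A B -> ->.
Qed.

Lemma cw_partially_expansive (f g : X -> X) :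
  cw_expansive f g -> partially_expansive f g 0.
Proof.
move=> [d d0 cw]; exists d => // C _ cC dC.
have [K [KC contK [x [y [Kx Ky xy]]]]] := continuum_in_positive_dim cC dC.
apply: contrapT => smallC; apply: xy.
have [j|z Kz] := cw _ contK; last by move: Kx Ky; rewrite Kz => -> ->.
rewrite ltNge; apply/negP => dK; apply: smallC; exists j.
apply: (le_trans dK); exact/diamS/image_subset.
Qed.

(** Partial expansiveness is applied to the continuum [K] inside [C], not to [C]:
    only for connected sets does a large diameter force a positive
    [e]-dimension. *)
Lemma partially_dw_expansive (f g : X -> X) :
  continuous f -> continuous g ->
  partially_expansive f g 0 -> dw_expansive f g 0.
Proof.
move=> cf cg [e e0 pe]; exists e => // C cC dC.
have [K [KC [_ cK kK] tK]] := continuum_in_positive_dim cC dC.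
have [k ek] := pe K tK cK (connected_top_dim_gt0 kK tK).
exists k; apply: (lt_le_trans _ (dim_epsS e (image_subset _ KC))).
apply: connected_dim_eps_gt0 => //; apply: connected_continuous_connected => //.
by apply: continuous_subspaceT; exact: continuous_iterz.
Qed.

End expansiveness.

Theorem proposition2p15 (R : realType) (X : metricType R)
  (hX : compact [set: X]) (f g : X -> X)
  (fK : cancel f g) (gK : cancel g f)
  (cf : continuous f) (cg : continuous g) :
  (dw_expansive f g 0 <-> partially_expansive f g 0) /\
  (partially_expansive f g 0 <-> cw_expansive f g).
Proof.
have dc := @dw_cw_expansive _ _ f g.
have cp := @cw_partially_expansive _ _ f g.
have pd := partially_dw_expansive cf cg.
by split; split; [move=> /dc/cp|move=> /pd|move=> /pd/dc|move=> /cp].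
Qed.
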